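(* Let $X$ be a compact metric space and $f_{0,\infty}=\{f_n\}_{n=0}^\infty$ a sequence of continuous self-maps of $X$. (i) $(X,f_{0,\infty})$ is mixing if and only if $(\mathcal{M}(X),\hat f_{0,\infty})$ is mixing. (ii) $(X,f_{0,\infty})$ is mild mixing if and only if $(\mathcal{M}(X),\hat f_{0,\infty})$ is mild mixing.
   Context: Let $(X,d)$ be a compact metric space. A non-autonomous dynamical system $(X,f_{0,\infty})$ is given by a sequence $f_{0,\infty}=\{f_n\}_{n=0}^\infty$ of continuous self-maps of $X$; write $f_0^n=f_{n-1}\circ\cdots\circ f_0$ for $n\ge1$. $\mathcal{M}(X)$ is the space of all Borel probability measures on $X$ with the Prohorov metric $\mathcal{P}_d(\mu,\nu)=\inf\{\epsilon>0:\mu(A)\le\nu(A^\epsilon)+\epsilon \text{ and } \nu(A)\le\mu(A^\epsilon)+\epsilon \text{ for all Borel } A\subset X\}$, where $A^\epsilon=\{x\in X: d(x,A)<\epsilon\}$; its topology is the weak$^*$-topology and $\mathcal{M}(X)$ is a compact metric space. The induced system $(\mathcal{M}(X),\hat f_{0,\infty})$, $\hat f_{0,\infty}=\{\hat f_n\}_{n=0}^\infty$, consists of the continuous maps $\hat f_n(\mu)(A)=\mu(f_n^{-1}(A))$. For nonempty open $U,V\subset X$ let $N(U,V)=\{n\ge1: f_0^n(U)\cap V\neq\emptyset\}$. $(X,f_{0,\infty})$ is transitive if $N(U,V)\ne\emptyset$ for all nonempty open $U,V$; it is mixing if for any nonempty open $U,V\subset X$ there is $N_0\ge1$ such that $n\in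 N(U,V)$ for all integers $n\ge N_0$; it is mild mixing if for every transitive non-autonomous system $(Y,g_{0,\infty})$ on a compact metric space $Y$, the product system $(X\times Y,f_{0,\infty}\times g_{0,\infty})$, given by the maps $f_n\times g_n$, is transitive. *)

(* Defs.v *)
From HB Require Import structures.
From mathcomp Require Import all_boot all_order all_algebra.
From mathcomp Require Import all_classical all_reals all_analysis.

Set Implicit Arguments.
Unset Strict Implicit.
Unset Printing Implicit Defensive.

Import Order.TTheory GRing.Theory Num.Theory.
Import numFieldNormedType.Exports.

Local Open Scope classical_set_scope.
Local Open Scope ring_scope.

(* A sequence [f : nat -> X -> X] is a non-autonomous system when every [f n]
   is continuous; continuity is a separate hypothesis wherever it is needed. *)

Fixpoint nds_iter (X : Type) (f : nat -> X -> X) (n : nat) : X -> X :=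
  if n is m.+1 then f m \o nds_iter f m else id.

Definition nds_hit (X : Type) (f : nat -> X -> X) (U V : set X) : set nat :=
  [set n | (1 <= n)%N /\ (nds_iter f n @` U) `&` V !=set0].

Definition nds_transitive (X : topologicalType) (f : nat -> X -> X) : Prop :=
  forall U V : set X, open U -> U !=set0 -> open V -> V !=set0 ->
    nds_hit f U V !=set0.

Definition nds_mixing (X : topologicalType) (f : nat -> X -> X) : Prop :=
  forall U V : set X, open U -> U !=set0 -> open V -> V !=set0 ->
    exists2 N0 : nat, (1 <= N0)%N &
      forall n : nat, (N0 <= n)%N -> nds_hit f U V n.

Definition nds_prod (X Y : Type) (f : nat -> X -> X) (g : nat -> Y -> Y)
    (n : nat) (p : X * Y) : X * Y := (f n p.1, g n p.2).

Definition nds_mild_mixing (R : realType) (X : metricType R)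
    (f : nat -> X -> X) : Prop :=
  forall (Y : metricType R) (g : nat -> Y -> Y),
    compact [set: Y] -> (forall n, continuous (g n)) ->
    nds_transitive g -> nds_transitive (nds_prod f g).

(* Measurable types of the library are pointed, so the Borel space of [X]
   takes a proof that [X] is nonempty; the point itself is irrelevant. *)

Definition pointed_by (T : Type) (ne : [set: T] !=set0) : Type := T.

HB.instance Definition _ (T : choiceType) (ne : [set: T] !=set0) :=
  Choice.on (pointed_by ne).
HB.instance Definition _ (T : choiceType) (ne : [set: T] !=set0) :=
  isPointed.Build (pointed_by ne) (projT1 (cid ne)).

Definition borelType (X : topologicalType) (ne : [set: X] !=set0) :=
  g_sigma_algebraType (@open X : set (set (pointed_by ne))).

HB.instance Definition _ (X : topologicalType) (ne : [set: X] !=set0) :=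
  Measurable.on (borelType ne).

(* Library measures are functions on all subsets, unconstrained on the
   non-measurable ones. Requiring the value 0 there makes [borel_prob X]
   contain each Borel probability measure exactly once. A space carrying a
   probability measure is nonempty, and [borel_prob X] is empty if [X] is. *)
Record borel_prob (R : realType) (X : metricType R) := BorelProb {
  bp_ne : [set: X] !=set0 ;
  bp_prob :> probability (borelType bp_ne) R ;
  bp_null : forall A : set X, ~ <<s @open X >> A -> bp_prob A = 0%E }.

HB.instance Definition _ (R : realType) (X : metricType R) :=
  gen_eqMixin (borel_prob X).
HB.instance Definition _ (R : realType) (X : metricType R) :=
  gen_choiceMixin (borel_prob X).

Section measurable_part.
Context d (T : measurableType d) (R : realType) (P : probability T R).

Definition measurable_part (A : set T) : \bar R :=
  if `[< measurable A >] then P A else 0%E.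

Lemma measurable_partE (A : set T) : measurable A -> measurable_part A = P A.
Proof. by move=> mA; rewrite /measurable_part asboolT. Qed.

Let part0 : measurable_part set0 = 0%E.
Proof. by rewrite measurable_partE// measure0. Qed.

Let part_ge0 A : (0 <= measurable_part A)%E.
Proof. by rewrite /measurable_part; case: ifP. Qed.

Let part_sigma_additive : semi_sigma_additive measurable_part.
Proof.
move=> F mF tF mUF; rewrite measurable_partE//.
rewrite [X in X @ _ --> _](_ : _ =
    fun n => (\sum_(0 <= i < n) P (F i))%E).
  exact: measure_semi_sigma_additive.
by apply/funext => n; apply: eq_bigr => i _; rewrite measurable_partE.
Qed.

HB.instance Definition _ := isMeasure.Build _ _ _ measurable_part
  part0 part_ge0 part_sigma_additive.

Let partT : measurable_part setT = 1%E.
Proof. by rewrite measurable_partE// probability_setT. Qed.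

HB.instance Definition _ :=
  Measure_isProbability.Build _ _ _ measurable_part partT.

End measurable_part.

Section borel_prob_theory.
Context (R : realType) (X : metricType R).
Implicit Types (mu nu : borel_prob X) (A : set X).

Lemma measurable_part_null (ne : [set: X] !=set0)
    (P : probability (borelType ne) R) A :
  ~ <<s @open X >> A -> measurable_part P A = 0%E.
Proof. by move=> nA; rewrite /measurable_part asboolF. Qed.

Definition borel_prob_of (ne : [set: X] !=set0)
    (P : probability (borelType ne) R) : borel_prob X :=
  @BorelProb R X ne (measurable_part P) (@measurable_part_null ne P).

Lemma borel_prob_eq mu nu :
  (forall A, <<s @open X >> A -> mu A = nu A) -> mu = nu.
Proof.
case: mu nu => ne P P0 [ne' Q Q0] /= PQ.
have E : ne = ne' by exact: Prop_irrelevance.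
case: _ / E Q Q0 PQ => Q Q0 PQ.
have PQ' : (P : set X -> \bar R) = (Q : set X -> \bar R).
  apply/funext => A; have [mA|nA] := pselect (<<s @open X >> A).
    exact: PQ.
  by rewrite (P0 _ nA) (Q0 _ nA).
have E : P = Q.
  case: P Q {P0 Q0 PQ} PQ' => p [[p1 p2] [p3] [p4] [p5] [p6] [p7] [p8]]
    [q [[q1 q2] [q3] [q4] [q5] [q6] [q7] [q8]]] /= E.
  case: _ / E q1 q2 q3 q4 q5 q6 q7 q8 => q1 q2 q3 q4 q5 q6 q7 q8.
  by rewrite (Prop_irrelevance q1 p1) (Prop_irrelevance q2 p2)
    (Prop_irrelevance q3 p3) (Prop_irrelevance q4 p4) (Prop_irrelevance q5 p5)
    (Prop_irrelevance q6 p6) (Prop_irrelevance q7 p7) (Prop_irrelevance q8 p8).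
case: _ / E Q0 {PQ PQ'} => Q0; congr BorelProb; exact: Prop_irrelevance.
Qed.

End borel_prob_theory.

Section prohorov.
Context (R : realType) (X : metricType R).
Implicit Types (A B : set X) (e : R) (mu nu rho : borel_prob X).

(* The infimum is taken in the extended reals, so that the distance to the
   empty set is +oo and its enlargement is empty. *)
Definition enlargement A e : set X :=
  [set x | (ereal_inf [set (mdist x a)%:E | a in A] < e%:E)%E].

Definition prohorov_bounds mu nu : set R :=
  [set e | 0 < e /\ forall A, <<s @open X >> A ->
    (mu A <= nu (enlargement A e) + e%:E)%E /\
    (nu A <= mu (enlargement A e) + e%:E)%E].

Definition prohorov mu nu : R := inf (prohorov_bounds mu nu).

Lemma enlargementP A e x :
  enlargement A e x <-> exists2 a, A a & mdist x a < e.
Proof.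
split=> [|[a Aa xa]]; last first.
  rewrite /enlargement/=; apply: (@le_lt_trans _ _ (mdist x a)%:E).
    by apply: ereal_inf_lbound; exists a.
  by rewrite lte_fin.
by move=> /ereal_inf_lt[_ [a Aa <-]]; rewrite lte_fin => xa; exists a.
Qed.

Lemma open_enlargement A e : open (enlargement A e).
Proof.
rewrite (_ : enlargement A e = \bigcup_(a in A) ball a e).
  apply: bigcup_open => a _; rewrite openE => x; rewrite ballEmdist/= => ax.
  apply/nbhs_ballP; exists (e - mdist a x) => /=; first by rewrite subr_gt0.
  move=> y; rewrite !ballEmdist/= ltrBrDl => xy.
  exact: le_lt_trans (metric_triangle _ x _) xy.
apply/seteqP; split => x /=.
  by move=> /enlargementP[a Aa xa]; exists a => //; rewrite ballEmdist/= metric_sym.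
by move=> [a Aa]; rewrite ballEmdist/= metric_sym => xa; apply/enlargementP; exists a.
Qed.

Lemma borel_enlargement A e : <<s @open X >> (enlargement A e).
Proof. by apply: sub_gen_smallest; exact: open_enlargement. Qed.

Lemma subset_enlargement A e : 0 < e -> A `<=` enlargement A e.
Proof. by move=> e0 x Ax; apply/enlargementP; exists x; rewrite ?mdistxx. Qed.

Lemma enlargementD A e1 e2 :
  enlargement (enlargement A e1) e2 `<=` enlargement A (e1 + e2).
Proof.
move=> x /enlargementP[y /enlargementP[a Aa ya] xy]; apply/enlargementP.
exists a => //; apply: le_lt_trans (metric_triangle _ y _) _.
by rewrite [ltRHS]addrC ltrD.
Qed.

Lemma borel_prob_le mu A B : <<s @open X >> A -> <<s @open X >> B ->
  A `<=` B -> (mu A <= mu B)%E.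
Proof. by move=> mA mB; apply: (@le_measure _ R (borelType (bp_ne mu)) mu); rewrite inE. Qed.

Lemma borel_prob_ge0 mu A : (0 <= mu A)%E.
Proof. exact: measure_ge0. Qed.

Lemma borel_prob_le1 mu A : <<s @open X >> A -> (mu A <= 1)%E.
Proof. exact: (@probability_le1 _ (borelType (bp_ne mu)) R mu). Qed.

Lemma prohorov_bounds1 mu nu : prohorov_bounds mu nu 1.
Proof.
split=> // A mA; split.
  apply: le_trans (borel_prob_le1 mu mA) _; exact/leeDr/borel_prob_ge0.
apply: le_trans (borel_prob_le1 nu mA) _; exact/leeDr/borel_prob_ge0.
Qed.

Lemma has_inf_prohorov_bounds mu nu : has_inf (prohorov_bounds mu nu).
Proof.
split; first by exists 1; exact: prohorov_bounds1.
by exists 0 => e [/ltW].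
Qed.

Lemma prohorov_ge0 mu nu : 0 <= prohorov mu nu.
Proof.
apply: lb_le_inf; first by exists 1; exact: prohorov_bounds1.
by move=> e [/ltW].
Qed.

Lemma prohorov_le mu nu e : prohorov_bounds mu nu e -> prohorov mu nu <= e.
Proof. by apply: ge_inf; have [] := has_inf_prohorov_bounds mu nu. Qed.

Lemma prohorovxx mu : prohorov mu mu = 0.
Proof.
apply/eqP; rewrite eq_le prohorov_ge0 andbT; apply/ler_addgt0Pl => e e0.
rewrite addr0; apply: prohorov_le; split => // A mA.
suff h : (mu A <= mu (enlargement A e) + e%:E)%E by [].
apply: le_trans (borel_prob_le mu mA (borel_enlargement A e) _) _.
  exact: subset_enlargement.
by rewrite leeDl// lee_fin ltW.
Qed.

Lemma prohorov_sym mu nu : prohorov mu nu = prohorov nu mu.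
Proof.
rewrite /prohorov; congr inf; apply/seteqP.
by split => e [e0 h]; split => // A /h[].
Qed.

Lemma prohorov_triangle nu mu rho :
  prohorov mu rho <= prohorov mu nu + prohorov nu rho.
Proof.
apply/ler_addgt0Pl => e e0.
have e20 : 0 < e / 2 by rewrite divr_gt0.
have [e1 [e10 h1] le1] := inf_adherent e20 (has_inf_prohorov_bounds mu nu).
have [e2 [e20' h2] le2] := inf_adherent e20 (has_inf_prohorov_bounds nu rho).
apply: (@le_trans _ _ (e1 + e2)); last first.
  apply: le_trans (lerD (ltW le1) (ltW le2)) _.
  by rewrite addrACA -splitr addrC.
apply: prohorov_le; split; first exact: addr_gt0.
move=> A mA; split.
  apply: le_trans (h1 _ mA).1 _.
  rewrite EFinD addeCA [leRHS]addeC leeD2r//.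
  apply: le_trans (h2 _ (borel_enlargement A e1)).1 _.
  rewrite leeD2r//; apply: borel_prob_le; try exact: borel_enlargement.
  exact: enlargementD.
apply: le_trans (h2 _ mA).2 _.
rewrite EFinD addeA leeD2r//.
apply: le_trans (h1 _ (borel_enlargement A e2)).2 _.
rewrite leeD2r//; apply: borel_prob_le; try exact: borel_enlargement.
by rewrite addrC; exact: enlargementD.
Qed.

Lemma bigcap_enlargement A : closed A ->
  \bigcap_n enlargement A n.+1%:R^-1 = A.
Proof.
move=> cA; apply/seteqP; split => x; last first.
  by move=> Ax n _; apply: subset_enlargement.
move=> h; apply: cA => B /nbhs_ballP[e /= e0 eB].
have [n _ ne] : exists2 n : nat, True & n.+1%:R^-1 < e.
  have [n] := ltr_add_invr e0; rewrite add0r => ne; by exists n.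
have /enlargementP[a Aa xa] := h n Logic.I.
exists a; split => //; apply: eB; rewrite ballEmdist/=; exact: lt_trans ne.
Qed.

Lemma borel_closed A : closed A -> <<s @open X >> A.
Proof.
move=> cA; rewrite -[A]setCK -setTD; apply: sigma_algebraCD.
by apply: sub_gen_smallest; exact: closed_openC.
Qed.

Lemma prohorov_closed_le mu nu A : prohorov mu nu = 0 -> closed A ->
  (mu A <= nu A)%E.
Proof.
move=> P0 cA.
have mA := borel_closed cA.
have small (d : R) : 0 < d -> (mu A <= nu (enlargement A d) + d%:E)%E.
  move=> d0; have [e [e0 h] le] := inf_adherent d0 (has_inf_prohorov_bounds mu nu).
  move: le; rewrite -/(prohorov mu nu) P0 add0r => ed.
  apply: le_trans (h _ mA).1 _; apply: leeD; last by rewrite lee_fin ltW.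
  apply: borel_prob_le; try exact: borel_enlargement.
  move=> x /enlargementP[a Aa xa]; apply/enlargementP; exists a => //.
  exact: lt_trans ed.
have cvg1 : nu (enlargement A n.+1%:R^-1) @[n --> \oo] --> nu A.
  rewrite -[X in nu X](bigcap_enlargement cA).
  apply: (@nonincreasing_cvg_mu _ _ _ nu).
  - by apply: le_lt_trans (borel_prob_le1 nu (borel_enlargement _ _)) _; rewrite ltry.
  - by move=> n; exact: borel_enlargement.
  - by rewrite bigcap_enlargement.
  move=> m n mn; apply/subsetPset => x /enlargementP[a Aa xa].
  apply/enlargementP; exists a => //; apply: lt_le_trans xa _.
  by rewrite lef_pV2 ?posrE// ler_nat.
rewrite -[leRHS]adde0.
apply: (@cvge_ge _ \oo _ _
  (fun n => nu (enlargement A n.+1%:R^-1) + (n.+1%:R^-1 : R)%:E)%E).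
  by apply: nearW => n; apply: small; rewrite invr_gt0.
apply: cvgeD => //; last exact: cvge_harmonic.
by rewrite fin_num_adde_defl.
Qed.

Lemma prohorov_positivity mu nu : prohorov mu nu = 0 -> mu = nu.
Proof.
move=> P0; apply: borel_prob_eq => A mA.
have E B : closed B -> mu B = nu B.
  move=> cB; apply/eqP; rewrite eq_le !prohorov_closed_le//.
  by rewrite prohorov_sym.
pose C : set (set X) := [set B | closed B].
have CI : setI_closed C by move=> B D; exact: closedI.
have mC : C `<=` <<s @open X >> by exact: borel_closed.
have mA' : <<s C >> A.
  apply: smallest_sub mA; first exact: smallest_sigma_algebra.
  move=> B oB; rewrite -[B]setCK -setTD; apply: sigma_algebraCD.
  by apply: sub_gen_smallest; exact: open_closedC.
case: mu nu {P0 mA} E => nem P P0 [nen Q Q0] /= E.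
have En : nem = nen by exact: Prop_irrelevance.
case: _ / En Q Q0 E => Q Q0 E.
apply: (@g_sigma_algebra_measure_unique _ R (borelType nem) C _
  (fun=> setT) _ _ P Q) => //.
- by apply/seteqP; split => // x _; exists 0%N.
- by move=> _; rewrite [ltLHS]probability_setT ltry.
Qed.

HB.instance Definition _ := @isMetric.Build R (borel_prob X) prohorov
  prohorovxx prohorov_positivity prohorov_sym prohorov_triangle.

End prohorov.

Section induced.
Context (R : realType) (X : metricType R) (f : X -> X).
Hypothesis cf : continuous f.

Lemma borel_preimage (ne : [set: X] !=set0) :
  measurable_fun [set: borelType ne] (f : borelType ne -> borelType ne).
Proof.
apply: (@measurability _ _ (borelType ne) (borelType ne) setT f (@open X)) => // _
  [B oB <-]; rewrite setTI.
by apply: sub_gen_smallest; apply: open_comp => // x _; exact: cf.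
Qed.

Definition borel_mfun (ne : [set: X] !=set0) :
    {mfun borelType ne >-> borelType ne} :=
  HB.pack_for {mfun borelType ne >-> borelType ne}
    (f : borelType ne -> borelType ne)
    (@isMeasurableFun.Build _ _ _ _ _ (@borel_preimage ne)).

Definition induced (mu : borel_prob X) : borel_prob X :=
  borel_prob_of (distribution mu (borel_mfun (bp_ne mu))).

Lemma inducedE (mu : borel_prob X) (A : set X) :
  <<s @open X >> A -> induced mu A = mu (f @^-1` A).
Proof. by move=> mA; rewrite /= measurable_partE. Qed.

End induced.

Definition nds_induced (R : realType) (X : metricType R) (f : nat -> X -> X)
    (cf : forall n, continuous (f n)) (n : nat) : borel_prob X -> borel_prob X :=
  induced (cf n).

(* Main.v *)
(* For the lifting direction, two measures mu, nu on a compact X are joint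
   marginals of mu \x nu; rounding both coordinates to a finite net reduces a
   visit from near mu to near nu to finitely many simultaneous visits between
   small balls of X. Mixing provides these at once; mild mixing provides them
   by adjoining one more copy of X to the test system Y for each pair of balls.
   Conversely, if mu gives mass more than 1/2 both to U and to the preimage of
   V, then these two sets meet. *)
From HB Require Import structures.
Require Import Defs.
From mathcomp Require Import all_boot all_order all_algebra.
From mathcomp Require Import all_classical all_reals all_analysis.

Set Implicit Arguments.
Unset Strict Implicit.
Unset Printing Implicit Defensive.

Import Order.TTheory GRing.Theory Num.Theory.
Import numFieldNormedType.Exports.

Local Open Scope classical_set_scope.
Local Open Scope ring_scope.

(** * The maximum metric on a product *)

Section product_metric.
Context (R : realType) (X Y : metricType R).
Implicit Types p q : X * Y.

(** The maximum is chosen because its balls are products of balls, so it induces the pseudometric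
    structure already present on [X * Y]. Products can then serve as test systems for mild
    mixing. *)
Definition prod_mdist p q : R := Num.max (mdist p.1 q.1) (mdist p.2 q.2).

Let prod_mdist_ge0 p q : 0 <= prod_mdist p q.
Proof. by rewrite /prod_mdist le_max mdist_ge0. Qed.

Let prod_mdist_positivity p q : prod_mdist p q = 0 -> p = q.
Proof.
case: p q => [x y] [x' y'] /eqP; rewrite eq_le ge_max/= => /andP[/andP[xx yy] _].
by congr pair; apply: mdist_positivity; apply/eqP; rewrite eq_le mdist_ge0 andbT.
Qed.

Let ball_prod_mdist p (e : R) : ball p e = [set q | prod_mdist p q < e].
Proof.
apply/seteqP; split => q /=; rewrite /prod_mdist gt_max.
  by move=> [/=]; rewrite !ballEmdist/= => -> ->.
by move=> /andP[h1 h2]; split; rewrite ballEmdist.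
Qed.

HB.instance Definition _ := PseudoMetric_isMetric.Build R (X * Y)%type
  prod_mdist_ge0 prod_mdist_positivity ball_prod_mdist.

End product_metric.

(** * Balls and finite nets *)

Section metric_space.
Context (R : realType) (X : metricType R).

Lemma metric_open_ball (x : X) (e : R) : open (ball x e).
Proof.
rewrite openE => y; rewrite ballEmdist/= => xy.
apply/nbhs_ballP; exists (e - mdist x y) => /=; first by rewrite subr_gt0.
move=> z; rewrite !ballEmdist/= ltrBrDl => yz.
exact: le_lt_trans (metric_triangle _ y _) yz.
Qed.

Lemma open_ball_subset (U : set X) x : open U -> U x ->
  exists2 e : R, 0 < e & ball x e `<=` U.
Proof.
move=> oU Ux; have : nbhs x U by exact: open_nbhs_nbhs.
by move=> /nbhs_ballP[e e0 eU]; exists e.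
Qed.

Lemma compact_finite_net (e : R) : compact [set: X] -> 0 < e ->
  exists s : seq X, forall x, exists2 y, y \in s & ball y e x.
Proof.
move=> cX e0; have [[x0 _]|nX] := pselect (exists x0 : X, True); last first.
  by exists [::] => x; exfalso; apply: nX; exists x.
(* Cover compactness is applied to a pointed copy of [X], which is why the empty space was split
   off. *)
pose pX : ptopologicalType := HB.pack (Metric.sort X) (isPointed.Build (Metric.sort X) x0).
have : cover_compact [set: pX] by rewrite -compact_cover.
move=> /(_ X setT (fun x => ball x e)) [].
- by move=> x _; exact: metric_open_ball.
- by move=> x _; exists x => //; exact: ballxx.
move=> D _ cD; exists (finmap.enum_fset D) => x.
by have [y yD xy] := cD x Logic.I; exists y.
Qed.

End metric_space.

(** * Measures as laws of random points *)

Section law.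
Context (R : realType) (X : metricType R).
Implicit Types mu nu : borel_prob X.

Definition is_law d (T : measurableType d) (P : probability T R) (s : T -> X)
    mu : Prop :=
  forall A, <<s @open X >> A -> measurable (s @^-1` A) /\ mu A = P (s @^-1` A).

(** The easy half of Strassen's theorem: where [s] lies in [A], [t] lies in the [e]-enlargement of
    [A], and symmetrically, so monotonicity of [P] gives both inequalities. *)
Lemma prohorov_coupling d (T : measurableType d) (P : probability T R)
    (s t : T -> X) mu nu (e : R) : 0 < e -> is_law P s mu -> is_law P t nu ->
  (forall w, mdist (s w) (t w) < e) -> prohorov mu nu <= e.
Proof.
move=> e0 smu tnu st; apply: prohorov_le; split => // A mA.
have mE : <<s @open X >> (enlargement A e) by exact: borel_enlargement.
have [sA muA] := smu _ mA; have [tA nuA] := tnu _ mA.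
have [sE muE] := smu _ mE; have [tE nuE] := tnu _ mE.
rewrite muA nuA muE nuE; split.
  rewrite (@le_trans _ _ (P (t @^-1` enlargement A e)))//; last first.
    by rewrite leeDl// lee_fin ltW.
  apply: le_measure; rewrite ?inE// => w Aw.
  by apply/enlargementP; exists (s w) => //; rewrite metric_sym.
rewrite (@le_trans _ _ (P (s @^-1` enlargement A e)))//; last first.
  by rewrite leeDl// lee_fin ltW.
apply: le_measure; rewrite ?inE// => w Aw.
by apply/enlargementP; exists (t w).
Qed.

Lemma law_exists d (T : measurableType d) (P : probability T R) (s : T -> X) :
  [set: X] !=set0 -> (forall A, <<s @open X >> A -> measurable (s @^-1` A)) ->
  exists mu, is_law P s mu.
Proof.
move=> ne ms.
have ms' : measurable_fun [set: T] (s : T -> borelType ne).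
  by move=> _ A mA; rewrite setTI; exact: ms.
pose s' : {mfun T >-> borelType ne} :=
  HB.pack_for {mfun T >-> borelType ne} (s : T -> borelType ne)
    (@isMeasurableFun.Build _ _ _ _ _ ms').
exists (borel_prob_of (distribution P s')) => A mA; split; first exact: ms.
by rewrite /= measurable_partE.
Qed.

Lemma law_id mu : is_law (bp_prob mu) id mu.
Proof. by []. Qed.

Lemma law_induced (f : nat -> X -> X) (cf : forall n, continuous (f n)) n
    d (T : measurableType d) (P : probability T R) (s : T -> X) mu :
  is_law P s mu ->
  is_law P (nds_iter f n \o s) (nds_iter (nds_induced cf) n mu).
Proof.
move=> smu; elim: n => // n IH A mA.
rewrite /= /nds_induced inducedE//.
apply: IH; have := borel_preimage (cf n) (ne := bp_ne mu) measurableT mA.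
by rewrite setTI.
Qed.

End law.

(** * Visits of the induced system from visits between balls *)

Section hits.
Context (R : realType) (X : metricType R) (f : nat -> X -> X).
Hypothesis cX : compact [set: X].
Hypothesis cf : forall n, continuous (f n).
Implicit Types mu nu : borel_prob X.

(** Each point is rounded to the first point of [s] whose ball contains it. Such a map takes
    finitely many values, each on a Borel set, so the preimage of any set [A] is Borel. *)
Lemma measurable_net_choice (e : R) (s : seq X) :
  (forall x, exists2 y, y \in s & ball y e x) ->
  exists c : X -> X, (forall x, c x \in s /\ ball (c x) e x) /\
    forall A, <<s @open X >> (c @^-1` A).
Proof.
move=> hs; have [[x0 _]|nX] := pselect (exists x0 : X, True); last first.
  exists id; split=> [x|A]; first by exfalso; apply: nX; exists x.
  rewrite (_ : _ @^-1` _ = set0); first exact: sigma_algebra0.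
  by apply/seteqP; split=> // x _; apply: nX; exists x.
have ne : [set: X] !=set0 by exists x0.
(* Closeness is made conditional on being covered, because the tail of a net need not be a net. The
   default value [x0] is taken only outside all the balls. *)
suff [c [cs mc]] : exists c : X -> X,
    (forall x, (exists2 y, y \in s & ball y e x) -> c x \in s /\ ball (c x) e x)
    /\ forall A, measurable (c @^-1` A : set (borelType ne)).
  by exists c; split => // x; exact/cs/hs.
elim: s {hs} => [|y s [c [cs mc]]].
  exists (fun=> x0); split=> [x []//|A]; rewrite preimage_cst.
  by case: ifP => _; [exact: measurableT|exact: measurable0].
exists (fun x => if `[< ball y e x >] then y else c x); split=> [x [z]|A].
  case: asboolP => [yx|nyx]; first by rewrite mem_head.
  rewrite in_cons => /orP[/eqP->//|zs zx].
  have [|cxs cx] := cs x; first by exists z.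
  by rewrite in_cons cxs orbT.
have my : measurable (ball y e : set (borelType ne)).
  by apply: sub_gen_smallest; exact: metric_open_ball.
rewrite (_ : _ @^-1` A = (ball y e `&` (fun=> y) @^-1` A)
  `|` (~` ball y e `&` c @^-1` A)).
  apply: measurableU; apply: measurableI => //; last exact: measurableC.
  rewrite preimage_cst.
  by case: ifP => _; [exact: measurableT|exact: measurable0].
apply/seteqP; split=> x /=.
  by case: asboolP => yx Ax; [left|right].
by case: asboolP => yx [] [].
Qed.

(** * The independent coupling of two measures *)

Section coupling.
Context mu nu.

Let P : probability _ R := (bp_prob mu \x bp_prob nu)%E.

Lemma law_fst : is_law P fst mu.
Proof.
move=> A mA; have mA' : measurable (A : set (borelType (bp_ne mu))) by [].
rewrite -setXT; split; first exact: measurableX.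
by rewrite [RHS]product_measure1E// [X in (_ * X)%E]probability_setT mule1.
Qed.

Lemma law_snd : is_law P snd nu.
Proof.
move=> A mA; have mA' : measurable (A : set (borelType (bp_ne nu))) by [].
rewrite -setTX; split; first exact: measurableX.
by rewrite [RHS]product_measure1E// [X in (X * _)%E]probability_setT mul1e.
Qed.

(** The map [g] is arbitrary: the rounded pair takes values in the finite set of pairs from [s], so
    every preimage is a finite union of measurable rectangles. *)
Lemma law_net (s : seq X) (c : X -> X) (g : X * X -> X) :
  (forall x, c x \in s) -> (forall A, <<s @open X >> (c @^-1` A)) ->
  exists rho, is_law P (fun p => g (c p.1, c p.2)) rho.
Proof.
move=> cs mc; apply: law_exists; first exact: (bp_ne mu).
move=> A _; rewrite (_ : _ @^-1` A =
  \bigcup_(k in [set` [seq (x, y) | x <- s, y <- s]] `&` g @^-1` A)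
    ((c @^-1` [set k.1]) `*` (c @^-1` [set k.2]))).
  apply: fin_bigcup_measurable => [|k _].
    exact/finite_setIl/finite_seq.
  by apply: measurableX; exact: mc.
apply/seteqP; split=> [[x y] /= Axy|[x y] [[u v] [_ Auv] []]/=].
  exists (c x, c y) => //; split=> //=.
  by apply/allpairsP; exists (c x, c y); split=> //=; exact: cs.
by move=> -> ->.
Qed.

End coupling.

(* Let (x, y) have law mu \x nu and let c round to the net. If g (a, b) is near
   a with f^n (g (a, b)) near b, then the law of g (c x, c y) is near mu and
   its n-th image is near nu. *)
Lemma induced_hit_net (U V : set (borel_prob X)) :
  open U -> U !=set0 -> open V -> V !=set0 ->
  exists (s : seq X) (e : R), 0 < e /\ forall n,
    (forall x y, x \in s -> y \in s -> nds_hit f (ball x e) (ball y e) n) ->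
    nds_hit (nds_induced cf) U V n.
Proof.
move=> oU [mu Umu] oV [nu Vnu].
have [e1 e10 hU] := open_ball_subset oU Umu.
have [e2 e20 hV] := open_ball_subset oV Vnu.
(* The coupling bound is non-strict, so [r] is kept strictly below both radii. Net and target balls
   get radius [r / 2]: rounding and choosing a nearby point together move less than [r]. *)
pose r := Num.min e1 e2 / 2; have r0 : 0 < r by rewrite divr_gt0// lt_min e10.
have [re1 re2] : r < e1 /\ r < e2.
  have m0 : 0 < Num.min e1 e2 by rewrite lt_min e10.
  have : r < Num.min e1 e2 by rewrite /r ltr_pdivrMr// ltr_pMr// ltr1n.
  by rewrite lt_min => /andP[].
have e0 : 0 < r / 2 by rewrite divr_gt0.
have [s net] := compact_finite_net cX e0.
exists s, (r / 2); split=> // n hit.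
have [c [cs mc]] := measurable_net_choice net.
have [x0 _] := bp_ne mu.
have n1 : (1 <= n)%N by have [] := hit _ _ (cs x0).1 (cs x0).1.
(* For net points, [g] picks a witness of the visit between their balls; elsewhere its value is
   irrelevant. *)
have /choice[g gP] : forall k : X * X, exists z, k.1 \in s -> k.2 \in s ->
    ball k.1 (r / 2) z /\ ball k.2 (r / 2) (nds_iter f n z).
  move=> [x y] /=; have [xs|] := boolP (x \in s); last by exists x.
  have [ys|] := boolP (y \in s); last by exists x.
  by have [_ [_ [[z xz <-] yz]]] := hit x y xs ys; exists z.
have [rho lrho] := law_net mu nu g (fun x => (cs x).1) mc.
have near_c x y : ball (c x) (r / 2) y -> mdist x y < r.
  move=> cy; have [_ cx] := cs x; have := ball_triangle (ball_sym cx) cy.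
  by rewrite -splitr ballEmdist.
split=> //; exists (nds_iter (nds_induced cf) n rho); split.
  exists rho => //; apply: hU; rewrite ballEmdist/=.
  apply: le_lt_trans re1; apply: prohorov_coupling (law_fst mu nu) lrho _ => //.
  move=> [x y] /=; apply: near_c.
  by have [] := gP (c x, c y) (cs x).1 (cs y).1.
apply: hV; rewrite ballEmdist/=.
apply: le_lt_trans re2.
apply: prohorov_coupling (law_snd mu nu) (law_induced cf n lrho) _ => //.
move=> [x y] /=; apply: near_c.
by have [] := gP (c x, c y) (cs x).1 (cs y).1.
Qed.

(** * Open conditions on mass *)

Lemma open_closed_mass_lt (C : set X) (r : R) : closed C ->
  open [set mu : borel_prob X | (mu C < r%:E)%E].
Proof.
move=> cC; rewrite openE => mu /= muC.
(* Upper semicontinuity on closed sets: the enlargements decrease to [C], so for some [n] their mass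
   plus the radius is still below [r]; that radius serves as the Prohorov radius. *)
have cvg1 : mu (enlargement C n.+1%:R^-1) @[n --> \oo] --> mu C.
  rewrite -[X in mu X](bigcap_enlargement cC).
  apply: (@nonincreasing_cvg_mu _ _ _ mu).
  - by apply: le_lt_trans (borel_prob_le1 mu (borel_enlargement _ _)) _; rewrite ltry.
  - by move=> n; exact: borel_enlargement.
  - by rewrite bigcap_enlargement//; exact: borel_closed.
  move=> m n mn; apply/subsetPset => x /enlargementP[a Aa xa].
  apply/enlargementP; exists a => //; apply: lt_le_trans xa _.
  by rewrite lef_pV2 ?posrE// ler_nat.
have cvg2 : (mu (enlargement C n.+1%:R^-1) + (n.+1%:R^-1 : R)%:E)%E
    @[n --> \oo] --> mu C.
  rewrite -[X in _ --> X]adde0; apply: cvgeD cvg1 cvge_harmonic.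
  by rewrite fin_num_adde_defl.
have [n _ /(_ n (leqnn n)) hn] := cvg2 _ (open_ereal_lt' muC).
have n0 : 0 < n.+1%:R^-1 :> R by rewrite invr_gt0.
apply/nbhs_ballP; exists n.+1%:R^-1 => //= nu; rewrite ballEmdist/= => munu.
(* The infimum yields an admissible [d] below the chosen radius. *)
have [|d [d0 h] dn] := @inf_adherent R (prohorov_bounds mu nu)
  (n.+1%:R^-1 - prohorov mu nu) _ (has_inf_prohorov_bounds mu nu).
  by rewrite subr_gt0.
move: dn; rewrite -/(prohorov mu nu) addrC subrK => dn.
apply: le_lt_trans (h _ (borel_closed cC)).2 _; apply: le_lt_trans hn.
apply: leeD; last by rewrite lee_fin ltW.
apply: borel_prob_le; try exact: borel_enlargement.
move=> x /enlargementP[a Ca xa]; apply/enlargementP; exists a => //.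
exact: lt_trans dn.
Qed.

(** For Borel [U] this says that [U] has mass above 1/2; bounding the complement puts openness in
    the form of a closed-set condition. *)
Definition half_mass (U : set X) : set (borel_prob X) :=
  [set mu | (mu (~` U) < (2^-1 : R)%:E)%E].

Lemma open_half_mass U : open U -> open (half_mass U).
Proof. by move=> oU; apply: open_closed_mass_lt; exact: open_closedC. Qed.

Lemma half_mass_nonempty U : open U -> U !=set0 -> half_mass U !=set0.
Proof.
move=> oU [x Ux]; have ne : [set: X] !=set0 by exists x.
have [//|mu lmu] :=
  (* The witness is the Dirac mass at a point of [U]. *)
  @law_exists R X _ (borelType ne) (dirac (x : borelType ne)) id ne.
exists mu; rewrite /half_mass/=; have [_ ->] := lmu _ (borel_closed (open_closedC oU)).
by rewrite /= diracE memNset/= ?lte_fin ?invr_gt0//; apply.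
Qed.

Lemma hit_of_half_mass (U V : set X) n : open U -> open V ->
  nds_hit (nds_induced cf) (half_mass U) (half_mass V) n -> nds_hit f U V n.
Proof.
move=> oU oV [n1 [_ [[mu Umu <-] Vmu]]]; split=> //.
apply: contrapT => nUV; move: Umu Vmu; rewrite /half_mass/=.
have bU := borel_closed (open_closedC oU).
have [bV ->] := law_induced cf n (@law_id R X mu) (borel_closed (open_closedC oV)).
move=> Umu Vmu.
(* Without a visit, the complements of [U] and of the preimage of [V] cover [X], yet each has mass
   below 1/2. *)
have : (1 <= mu (~` U) + mu (nds_iter f n @^-1` (~` V)))%E.
  rewrite -[leLHS](@probability_setT _ (borelType (bp_ne mu)) R mu).
  apply: le_trans (measureU2 (bp_prob mu) bU bV).
  apply: borel_prob_le; first exact: (@measurableT _ (borelType (bp_ne mu))).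
    exact: (@measurableU _ (borelType (bp_ne mu))).
  move=> x _; have [Ux|] := pselect (U x); last by left.
  by right=> /= Vx; apply: nUV; exists (nds_iter f n x).
apply/negP; rewrite -ltNge [1%R]splitr EFinD.
by rewrite div1r; exact: lteD.
Qed.

End hits.

(** * Simultaneous visits and product systems *)

Lemma nds_mixing_seq (X : topologicalType) (f : nat -> X -> X) (K : eqType)
    (A B : K -> set X) (s : seq K) : nds_mixing f ->
  (forall k, open (A k) /\ A k !=set0) -> (forall k, open (B k) /\ B k !=set0) ->
  exists2 N, (1 <= N)%N & forall n, (N <= n)%N ->
    forall k, k \in s -> nds_hit f (A k) (B k) n.
Proof.
move=> mf hA hB; elim: s => [|k s [N N1 IH]]; first by exists 1%N.
have [M M1 hM] := mf _ _ (hA k).1 (hA k).2 (hB k).1 (hB k).2.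
(* The largest of finitely many thresholds serves all pairs. *)
exists (maxn M N) => [|n]; first by rewrite leq_max M1.
rewrite geq_max => /andP[Mn Nn] l; rewrite in_cons => /orP[/eqP->|ls].
  exact: hM.
exact: IH.
Qed.

Lemma open_setX (X Y : topologicalType) (U : set X) (V : set Y) :
  open U -> open V -> open (U `*` V).
Proof.
move=> oU oV; rewrite openE => -[x y] [/= Ux Vy].
by exists (U, V) => //; split; exact: open_nbhs_nbhs.
Qed.

Lemma nds_iter_prod (X Y : Type) (f : nat -> X -> X) (g : nat -> Y -> Y) n p :
  nds_iter (nds_prod f g) n p = (nds_iter f n p.1, nds_iter g n p.2).
Proof. by elim: n => [|n IH] /=; [case: p|rewrite IH]. Qed.

Lemma nds_hit_prod (X Y : Type) (f : nat -> X -> X) (g : nat -> Y -> Y)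
    (U V : set X) (W Z : set Y) n :
  nds_hit (nds_prod f g) (U `*` W) (V `*` Z) n <->
  nds_hit f U V n /\ nds_hit g W Z n.
Proof.
split=> [[n1 [_ [[[x y] [/= Ux Wy] <-]]]]|].
  rewrite nds_iter_prod => -[/= Vx Zy]; split; split=> //.
    by exists (nds_iter f n x); split=> //; exists x.
  by exists (nds_iter g n y); split=> //; exists y.
move=> [[n1 [_ [[x Ux <-] Vx]]] [_ [_ [[y Wy <-] Zy]]]]; split=> //.
exists (nds_iter f n x, nds_iter g n y); split=> //.
by exists (x, y) => //; rewrite nds_iter_prod.
Qed.

(** Open boxes form a base of the product topology, so transitivity need only be tested on them. *)
Lemma nds_transitive_prod (X Y : topologicalType) (f : nat -> X -> X)
    (g : nat -> Y -> Y) :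
  (forall (U V : set X) (W Z : set Y), open U -> U !=set0 -> open V ->
    V !=set0 -> open W -> W !=set0 -> open Z -> Z !=set0 ->
    exists2 n, nds_hit f U V n & nds_hit g W Z n) ->
  nds_transitive (nds_prod f g).
Proof.
have box (U : set (X * Y)) : open U -> U !=set0 ->
    exists (A : set X) (B : set Y),
      [/\ open A, A !=set0, open B, B !=set0 & A `*` B `<=` U].
  rewrite openE => oU [[x y] /oU[[A B] [/= xA yB] ABU]].
  exists A^°, B^°; split; try exact: open_interior.
  - by exists x.
  - by exists y.
  by move=> [a b] [/= /interior_subset ? /interior_subset ?]; exact: ABU.
move=> h U V oU U0 oV V0.
have [A [B [oA A0 oB B0 ABU]]] := box U oU U0.
have [C [D [oC C0 oD D0 CDV]]] := box V oV V0.
have [n fn gn] := h A C B D oA A0 oC C0 oB B0 oD D0.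
have /nds_hit_prod[n1 [q [[p /ABU Up <-] /CDV Vp]]] := conj fn gn.
by exists n; split=> //; exists (nds_iter (nds_prod f g) n p); split=> //; exists p.
Qed.

(** Induction over all test systems at once: the pair indexed by [k] is absorbed by replacing [Y]
    with [X * Y], which is again compact, continuous and, by mild mixing of [f], transitive. *)
Lemma nds_mild_mixing_seq (R : realType) (X : metricType R) (f : nat -> X -> X)
    (K : eqType) (A B : K -> set X) (s : seq K) :
  compact [set: X] -> (forall n, continuous (f n)) -> nds_mild_mixing f ->
  (forall k, open (A k) /\ A k !=set0) -> (forall k, open (B k) /\ B k !=set0) ->
  forall (Y : metricType R) (g : nat -> Y -> Y),
    compact [set: Y] -> (forall n, continuous (g n)) -> nds_transitive g ->
  forall W Z : set Y, open W -> W !=set0 -> open Z -> Z !=set0 ->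
  exists2 n, (forall k, k \in s -> nds_hit f (A k) (B k) n) & nds_hit g W Z n.
Proof.
move=> cX cf mf hA hB.
elim: s => [|k s IH] Y g cY cg tg W Z oW W0 oZ Z0.
  by have [n hn] := tg W Z oW W0 oZ Z0; exists n.
have [oA [a Aa]] := hA k; have [oB [b Bb]] := hB k.
have [w Ww] := W0; have [z Zz] := Z0.
have [|||||||n hn /nds_hit_prod[fn gn]] :=
  IH (X * Y)%type (nds_prod f g) _ _ _ (A k `*` W) (B k `*` Z).
- by rewrite -setXTT; exact: compact_setX.
- move=> n p.
  have h1 : f n q.1 @[q --> p] --> f n p.1.
    by apply: (@continuous_comp _ _ _ fst); [exact: cvg_fst|exact: cf].
  have h2 : g n q.2 @[q --> p] --> g n p.2.
    by apply: (@continuous_comp _ _ _ snd); [exact: cvg_snd|exact: cg].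
  exact: (cvg_pair h1 h2).
- exact: mf.
- exact: open_setX.
- by exists (a, w).
- exact: open_setX.
- by exists (b, z).
by exists n => // l; rewrite in_cons => /orP[/eqP->|/hn].
Qed.

Theorem theorem2p11 (R : realType) (X : metricType R) (f : nat -> X -> X)
    (cX : compact [set: X]) (cf : forall n : nat, continuous (f n)) :
  (nds_mixing f <-> nds_mixing (nds_induced cf)) /\
  (nds_mild_mixing f <-> nds_mild_mixing (nds_induced cf)).
Proof.
have ballne (e : R) : 0 < e -> forall x : X, open (ball x e) /\ ball x e !=set0.
  by move=> e0 x; split; [exact: metric_open_ball|exists x; exact: ballxx].
split; split=> mf.
- move=> U V oU U0 oV V0.
  have [s [e [e0 hs]]] := induced_hit_net cX cf oU U0 oV V0.
  (* The finite family consists of the ball pairs indexed by pairs of net points. *)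
  have [N N1 hN] := nds_mixing_seq [seq (x, y) | x <- s, y <- s] mf
    (fun k => ballne e e0 k.1) (fun k => ballne e e0 k.2).
  exists N => // n Nn; apply: hs => x y xs ys; apply: (hN n Nn (x, y)).
  by apply/allpairsP; exists (x, y).
- move=> U V oU U0 oV V0.
  have [N N1 hN] := mf _ _ (open_half_mass oU) (half_mass_nonempty oU U0)
    (open_half_mass oV) (half_mass_nonempty oV V0).
  by exists N => // n /hN; exact: hit_of_half_mass.
- move=> Y g cY cg tg; apply: nds_transitive_prod => U V W Z oU U0 oV V0 oW W0 oZ Z0.
  have [s [e [e0 hs]]] := induced_hit_net cX cf oU U0 oV V0.
  have [n hn gn] := nds_mild_mixing_seq [seq (x, y) | x <- s, y <- s] cX cf mf
    (fun k => ballne e e0 k.1) (fun k => ballne e e0 k.2) cY cg tg oW W0 oZ Z0.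
  exists n => //; apply: hs => x y xs ys; apply: (hn (x, y)).
  by apply/allpairsP; exists (x, y).
- move=> Y g cY cg tg; apply: nds_transitive_prod => U V W Z oU U0 oV V0 oW W0 oZ Z0.
  (* Replacing [U] and [V] by their half-mass sets keeps the same time [n] for the visit in [Y]. *)
  have [||||n /nds_hit_prod[fn gn]] := mf Y g cY cg tg
    (half_mass U `*` W) (half_mass V `*` Z).
  + exact/open_setX/oW/open_half_mass.
  + have [m Um] := half_mass_nonempty oU U0; have [w Ww] := W0.
    by exists (m, w).
  + exact/open_setX/oZ/open_half_mass.
  + have [m Vm] := half_mass_nonempty oV V0; have [z Zz] := Z0.
    by exists (m, z).
  by exists n => //; exact: (hit_of_half_mass oU oV fn).
Qed.
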